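(* Let $b\ge2$, $s\ge1$, $d\ge1$, $t\ge0$ be integers and let $(\mathbf{x}_n)_{n\ge0}$ be a $d$-admissible $(t,s)$-sequence in base $b$. Then for every integer $m\ge 9(d+t)s^2$, $$1+\min_{0\le Q<b^m}\ \max_{1\le N\le b^m,\ \mathbf{w}\in E_m^s} N\,D^*\big((\mathbf{x}_{n\oplus Q}\oplus\mathbf{w})_{0\le n<N}\big)\ \ge\ b^{-d}K_{d,t,s+1}^{-s}m^{s},\qquad\text{where } K_{d,t,s+1}=4(d+t)s^2,$$ and $E_m=\{[y]_m:y\in[0,1)\}$.
   Context: Fix an integer base $b\ge 2$ and let $Z_b=\{0,\dots,b-1\}$. Each $x\in[0,1)$ is identified with its $b$-adic digit sequence $x=\sum_{j\ge1}x_jb^{-j}$, $x_j\in Z_b$, chosen not to end in infinitely many digits $b-1$. Truncation: $[x]_m=\sum_{j=1}^m x_jb^{-j}$; so $E_m=\{ab^{-m}:0\le a<b^m\}$. Digital shift: $x\oplus\gamma=\sum_j v_jb^{-j}$ with $v_j\in Z_b$, $v_j\equiv x_j+\gamma_j\pmod b$; $x\ominus\gamma$ uses $v_j\equiv x_j-\gamma_j\pmod b$; on $[0,1)^s$ these and truncation act coordinatewise. For integers $n,k\ge0$, $n\oplus k$ and $n\ominus k$ are the integers whose base-$b$ digits are the digitwise sums, resp. differences, mod $b$ of the digits of $n$ and $k$ (for $n,Q\in[0,b^m)$ this uses $m$-digit expansions, so $n\oplus Q\in[0,b^m)$). Valuations: if $v=\sum_jv_jb^{-j}$ has $v_1=\dots=v_k=0$,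 $v_{k+1}\ne0$, then $\|v\|_b=b^{-k-1}$ ($\|v\|_b=0$ if all digits vanish); for $\mathbf{v}\in[0,1)^s$, $\|\mathbf{v}\|_b=\prod_i\|v^{(i)}\|_b$; for an integer $n$ with $b^k\le n<b^{k+1}$, $\|n\|_b=b^k$. Discrepancy: for points $(\mathbf{y}_n)_{0\le n<N}$ in $[0,1)^s$ and $\boldsymbol\gamma\in(0,1]^s$, $J_{\boldsymbol\gamma}=\prod_i[0,\gamma_i)$, $\Delta=\#\{0\le n<N:\mathbf{y}_n\in J_{\boldsymbol\gamma}\}-N\gamma_1\cdots\gamma_s$, and $D^*((\mathbf{y}_n)_{0\le n<N})=\sup_{\boldsymbol\gamma\in(0,1]^s}|\Delta|/N$. Nets and sequences: for integers $0\le u\le m$ and $\mathbf{e}\in\mathbb{N}^s$, a $(u,m,\mathbf{e},s)$-net in base $b$ is a set of $b^m$ points in $[0,1)^s$ such that every box $J=\prod_i[a_ib^{-d_i},(a_i+1)b^{-d_i})$ with integers $d_i\ge0$, $0\le a_i<b^{d_i}$, $e_i\mid d_i$, $\mathrm{Vol}(J)\ge b^{u-m}$ contains exactly $b^m\mathrm{Vol}(J)$ of the points. A sequence $(\mathbf{x}_n)_{n\ge0}$ in $[0,1)^s$ is a $(u,\mathbf{e},s)$-sequence in base $b$ if for all integers $k\ge0$ and $m>u$ the points $[\mathbf{x}_n]_m$, $kb^m\le n<(k+1)b^m$, form a $(u,m,\mathbf{e},s)$-net. A $(t,s)$-sequence is a $(t,(1,\dots,1),s)$-sequence. A sequence $(\mathbf{x}_n)_{n\ge0}$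 is $d$-admissible in base $b$ if $\inf_{n>k\ge0}\|n\ominus k\|_b\,\|\mathbf{x}_n\ominus\mathbf{x}_k\|_b\ge b^{-d}$. *)

(* Defs.v *)
From HB Require Import structures.
From mathcomp Require Import all_boot all_order all_algebra.
From mathcomp Require Import all_classical all_reals all_analysis.

Set Implicit Arguments.
Unset Strict Implicit.
Unset Printing Implicit Defensive.

Import Order.TTheory GRing.Theory Num.Theory.
Import numFieldNormedType.Exports.

Local Open Scope classical_set_scope.
Local Open Scope ring_scope.

(* Digit sequences v : nat -> nat are 0-based: v j is the coefficient of
   b^-(j+1), written v_(j+1) in the 1-based convention. *)

(* For x in [0,1[ this is the b-adic expansion that does not end in
   infinitely many digits b-1. *)
Definition digit (R : realType) (b : nat) (x : R) (j : nat) : nat :=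
  (Num.truncn (x * b%:R ^+ j.+1) %% b)%N.

Definition value (R : realType) (b : nat) (v : nat -> nat) : R :=
  limn (series (fun j => (v j)%:R * b%:R ^- j.+1 : R)).

Definition truncation (R : realType) (b m : nat) (x : R) : R :=
  \sum_(j < m) (digit b x j)%:R * b%:R ^- j.+1.

Definition truncation_set (R : realType) (b m : nat) : set R :=
  [set truncation b m y | y in [set y : R | 0 <= y < 1]].

Definition addmod (b p q : nat) : nat := ((p + q) %% b)%N.
Definition submod (b p q : nat) : nat := ((p + (b - q)) %% b)%N.

Definition digital_shift (R : realType) (b : nat) (x g : R) : R :=
  value R b (fun j => addmod b (digit b x j) (digit b g j)).

(* The difference is kept as a digit sequence: it may end in infinitely many
   digits b-1, and the valuation below reads the digits v_j themselves, not
   those of the normalized expansion of the sum of the series. *)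
Definition dsub (R : realType) (b : nat) (x y : R) : nat -> nat :=
  fun j => submod b (digit b x j) (digit b y j).

Definition valuation (R : realType) (b : nat) (v : nat -> nat) : R :=
  if pselect (exists k, v k != 0%N) is left ex
  then b%:R ^- (ex_minn ex).+1 else 0.

Definition ndigit (b n j : nat) : nat := ((n %/ b ^ j) %% b)%N.

(* For b >= 2 the digits of n and k at positions >= n + k all vanish. *)
Definition nadd (b n k : nat) : nat :=
  (\sum_(j < n + k) addmod b (ndigit b n j) (ndigit b k j) * b ^ j)%N.
Definition nsub (b n k : nat) : nat :=
  (\sum_(j < n + k) submod b (ndigit b n j) (ndigit b k j) * b ^ j)%N.

(* Only meaningful for n > 0. *)
Definition nvaluation (b n : nat) : nat := (b ^ trunc_log b n)%N.

Section points.
Context {R : realType} {s : nat}.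
Implicit Types (y x : nat -> 'I_s -> R) (g w : 'I_s -> R).

Definition in_cube (p : 'I_s -> R) : Prop := forall i, 0 <= p i < 1.

Definition Delta (N : nat) y g : R :=
  #|[pred n : 'I_N | [forall i, 0 <= y n i < g i]]|%:R - N%:R * \prod_i g i.

(* For N > 0 the set is nonempty and bounded above by 1, so that sup is the
   actual supremum. *)
Definition star_discrepancy (N : nat) y : R :=
  sup [set `|Delta N y g| / N%:R | g in [set g | forall i, 0 < g i <= 1]].

Definition box_volume (b : nat) (d : 'I_s -> nat) : R :=
  \prod_i b%:R ^- d i.

(* The points y_0, ..., y_(b^m-1) are counted with multiplicity. *)
Definition is_net (b u m : nat) (e : 'I_s -> nat) y : Prop :=
  (forall n, (n < b ^ m)%N -> in_cube (y n)) /\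
  forall d a : 'I_s -> nat,
    (forall i, (a i < b ^ d i)%N) -> (forall i, (e i %| d i)%N) ->
    b%:R ^+ u / b%:R ^+ m <= box_volume b d ->
    #|[pred n : 'I_(b ^ m) |
        [forall i, (a i)%:R / b%:R ^+ d i <= y n i
                   < (a i).+1%:R / b%:R ^+ d i]]|%:R
      = b%:R ^+ m * box_volume b d.

Definition is_ue_sequence (b u : nat) (e : 'I_s -> nat) x : Prop :=
  (forall n, in_cube (x n)) /\
  forall k m, (u < m)%N ->
    is_net b u m e (fun n i => truncation b m (x (k * b ^ m + n)%N i)).

Definition is_ts_sequence (b t : nat) x : Prop :=
  is_ue_sequence b t (fun=> 1%N) x.

Definition valuation_sub (b : nat) (p q : 'I_s -> R) : R :=
  \prod_i valuation R b (dsub b (p i) (q i)).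

(* The set is nonempty and bounded below by 0. *)
Definition admissible (b d : nat) x : Prop :=
  b%:R ^- d <=
    inf [set (nvaluation b (nsub b nk.1 nk.2))%:R
               * valuation_sub b (x nk.1) (x nk.2)
        | nk in [set nk : nat * nat | (nk.2 < nk.1)%N]].

Definition shifted (b : nat) x (Q : nat) w : nat -> 'I_s -> R :=
  fun n i => digital_shift b (x (nadd b n Q) i) (w i).

(* sup and inf over nonempty finite sets: a maximum and a minimum. *)
Definition max_discrepancy (b m : nat) x (Q : nat) : R :=
  sup [set Nw.1%:R * star_discrepancy Nw.1 (shifted b x Q Nw.2)
      | Nw in [set Nw : nat * ('I_s -> R) |
          (1 <= Nw.1 <= b ^ m)%N /\ forall i, truncation_set b m (Nw.2 i)]].

Definition minmax_discrepancy (b m : nat) x : R :=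
  inf [set max_discrepancy b m x Q | Q in [set Q | (Q < b ^ m)%N]].

End points.

(* Main.v *)
Require Import Defs.
From HB Require Import structures.
From mathcomp Require Import all_boot all_order all_algebra.
From mathcomp Require Import all_classical all_reals all_analysis.
From mathcomp Require Import zify ring lra.

(* Fix Q and let L = d + t + 1, h = m / L.  Take N < b^m whose nonzero base-b
   digits are h digits b-1, in positions congruent to t modulo L counted from the
   low end, and G < b^m whose nonzero digits are b-1 in positions L, 2L, ..., hL
   after the radix point.  With n0 = N (+) Q, choose the shift w so that x_n0 (+) w
   starts with the digits of G in every coordinate, and test the box
   [0, G / b^m)^s.  Being lexicographically below a digit b-1 just means differing
   from it, so for a counted point x_n, where n = n' (+) Q with n' < N, coordinate
   i first differs from that of x_n0 at a position L v_i, while n first differs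
   from n0 at t + L l.  Admissibility forbids such a pair (l, v) when the sum of
   the v_i exceeds l, and the net property gives exactly the expected count
   otherwise: the spacing L leaves no pair in the window where neither applies.
   So every pair contributes a nonpositive amount to the discrepancy, and the
   pairs with sum v_i = l + 1 contribute -(b-1)^(s+1) / b^(d+1) each.  There are
   at least (h / s)^s of them. *)

Set Implicit Arguments.
Unset Strict Implicit.
Unset Printing Implicit Defensive.

Import Order.TTheory GRing.Theory Num.Theory.
Local Open Scope ring_scope.

(** * Base-b digits of natural numbers *)

Lemma addmod_inj (b p q r : nat) :
  (p < b)%N -> (q < b)%N -> addmod b p r = addmod b q r -> p = q.
Proof.
move=> pb qb /eqP; rewrite /addmod eqn_modDr !modn_small //; exact: eqP.
Qed.

Lemma submodK (b p q : nat) :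
  (p < b)%N -> (q < b)%N -> addmod b q (submod b p q) = p.
Proof.
move=> pb qb; rewrite /addmod /submod modnDmr addnC -addnA subnK ?(ltnW qb) //.
by rewrite modnDr modn_small.
Qed.

Lemma submod_eq0 (b p q : nat) :
  (p < b)%N -> (q < b)%N -> (submod b p q == 0%N) = (p == q).
Proof.
move=> pb qb; apply/eqP/eqP => [h|->].
  by have := submodK pb qb; rewrite h /addmod addn0 modn_small.
by rewrite /submod subnKC ?(ltnW qb) // modnn.
Qed.

Lemma ndigitS (b n j : nat) : ndigit b n j.+1 = ndigit b (n %/ b) j.
Proof. by rewrite /ndigit expnS divnMA. Qed.

Lemma ndigit_div (b n j k : nat) : ndigit b (n %/ b ^ k) j = ndigit b n (k + j).
Proof. by rewrite /ndigit expnD divnMA. Qed.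

Lemma ltn_ndigit (b n j : nat) : (0 < b)%N -> (ndigit b n j < b)%N.
Proof. by move=> b0; rewrite ltn_mod. Qed.

Lemma ndigit_small (b n j : nat) : (n < b ^ j)%N -> ndigit b n j = 0%N.
Proof. by move=> nb; rewrite /ndigit divn_small // mod0n. Qed.

Lemma ndigit_inj (b : nat) : (1 < b)%N -> injective (ndigit b).
Proof.
move=> b1 u; elim/ltn_ind: u => u IH v E.
have E' j : ndigit b u j = ndigit b v j by rewrite E.
have e0 : (u %% b = v %% b)%N by have := E' 0%N; rewrite /ndigit expn0 !divn1.
have eb : ndigit b (u %/ b) = ndigit b (v %/ b).
  by apply/funext => j; rewrite -!ndigitS.
case: (posnP u) => [u0|u0].
  case: (posnP v) => [->//|v0].
  have v_lt := ltn_expl v b1.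
  have : (v = 0)%N.
    elim/ltn_ind: v {E e0 eb v0 v_lt} E' => v IHv E'.
    case: (posnP v) => // v0.
    have vb : (v %/ b = 0)%N.
      apply: IHv; first by rewrite ltn_Pdiv.
      by move=> j; rewrite -ndigitS -E' u0 /ndigit !div0n.
    have := E' 0%N; rewrite /ndigit expn0 !divn1 u0 mod0n => vm.
    by rewrite (divn_eq v b) vb -vm.
  by move=> v0'; rewrite v0' in v0.
have h := IH _ (ltn_Pdiv b1 u0) _ eb.
by rewrite (divn_eq u b) (divn_eq v b) h e0.
Qed.

Lemma ndigit_sum (b M : nat) (f : nat -> nat) (k : nat) :
    (0 < b)%N -> (forall j, (f j < b)%N) ->
  ndigit b (\sum_(j < M) f j * b ^ j)%N k = if (k < M)%N then f k else 0%N.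
Proof.
move=> b0; elim: M f k => [|M IH] f k fb.
  by rewrite big_ord0 /ndigit div0n mod0n.
rewrite big_ord_recl /= expn0 muln1.
have -> : (\sum_(i < M) f (bump 0 i) * b ^ bump 0 i =
           (\sum_(i < M) f i.+1 * b ^ i) * b)%N.
  rewrite big_distrl /=; apply: eq_bigr => i _.
  by rewrite /bump /= add1n expnS mulnCA mulnC.
case: k => [|k].
  by rewrite /ndigit expn0 divn1 addnC modnMDl modn_small.
rewrite ndigitS addnC divnMDl // divn_small // addn0 (IH (fun j => f j.+1)) //.
Qed.

Lemma ltn_sum_digits (b M : nat) (f : nat -> nat) :
  (0 < b)%N -> (forall j, (f j < b)%N) -> (\sum_(j < M) f j * b ^ j < b ^ M)%N.
Proof.
move=> b0 fb; elim: M => [|M IH]; first by rewrite big_ord0.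
rewrite big_ord_recr /= expnS.
apply: (@leq_trans ((f M).+1 * b ^ M)%N); first by rewrite mulSn ltn_add2r.
by rewrite leq_mul2r fb orbT.
Qed.

Lemma ndigit_nadd (b n k j : nat) : (1 < b)%N ->
  ndigit b (nadd b n k) j = addmod b (ndigit b n j) (ndigit b k j).
Proof.
move=> b1; have b0 := ltnW b1.
rewrite /nadd (@ndigit_sum _ _ (fun j => addmod b (ndigit b n j) (ndigit b k j))) //;
  last by move=> i; rewrite ltn_mod.
case: ltnP => // h; have jb := ltn_expl j b1.
rewrite /addmod !ndigit_small ?mod0n //; apply: leq_ltn_trans jb; lia.
Qed.

Lemma ndigit_nsub (b n k j : nat) : (1 < b)%N ->
  ndigit b (nsub b n k) j = submod b (ndigit b n j) (ndigit b k j).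
Proof.
move=> b1; have b0 := ltnW b1.
rewrite /nsub (@ndigit_sum _ _ (fun j => submod b (ndigit b n j) (ndigit b k j))) //;
  last by move=> i; rewrite ltn_mod.
case: ltnP => // h; have jb := ltn_expl j b1.
rewrite !(@ndigit_small b _ j) ?/submod ?subn0 ?modnn //;
  apply: leq_ltn_trans jb; lia.
Qed.

Lemma ltn_expn_digits (b n m : nat) : (1 < b)%N ->
  (forall j, (m <= j)%N -> ndigit b n j = 0%N) -> (n < b ^ m)%N.
Proof.
move=> b1 n0; have bm : (0 < b ^ m)%N by rewrite expn_gt0 ltnW.
suff : (n %/ b ^ m = 0)%N by move=> /eqP; rewrite eqn0Ngt divn_gt0 // -ltnNge.
apply: (ndigit_inj b1); apply/funext => j.
by rewrite ndigit_div n0 ?leq_addr // /ndigit div0n mod0n.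
Qed.

Lemma ndigit_ge (b n m j : nat) : (1 < b)%N -> (n < b ^ m)%N -> (m <= j)%N ->
  ndigit b n j = 0%N.
Proof.
move=> b1 nm mj; apply: ndigit_small; apply: leq_trans nm _.
by rewrite leq_exp2l.
Qed.

Lemma ltn_nadd (b n k m : nat) : (1 < b)%N -> (n < b ^ m)%N -> (k < b ^ m)%N ->
  (nadd b n k < b ^ m)%N.
Proof.
move=> b1 nm km; apply: ltn_expn_digits => // j mj.
by rewrite ndigit_nadd // !(ndigit_ge b1 _ mj) // /addmod mod0n.
Qed.

Lemma ltn_nsub (b n k m : nat) : (1 < b)%N -> (n < b ^ m)%N -> (k < b ^ m)%N ->
  (nsub b n k < b ^ m)%N.
Proof.
move=> b1 nm km; apply: ltn_expn_digits => // j mj.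
by rewrite ndigit_nsub // !(ndigit_ge b1 _ mj) // /submod subn0 modnn.
Qed.

Lemma nsubK (b n k : nat) : (1 < b)%N -> nadd b k (nsub b n k) = n.
Proof.
move=> b1; apply: (ndigit_inj b1); apply/funext => j.
by rewrite ndigit_nadd // ndigit_nsub // submodK // ltn_ndigit // ltnW.
Qed.

Lemma nadd_inj (b k : nat) : (1 < b)%N -> injective (nadd b ^~ k).
Proof.
move=> b1 u v /= E; apply: (ndigit_inj b1); apply/funext => j.
have := congr1 (fun z => ndigit b z j) E; rewrite !ndigit_nadd //.
by apply: addmod_inj; rewrite ltn_ndigit // ltnW.
Qed.

(* [k] is the most significant position at which [u] and [v] differ. *)
Definition topdiff (b u v k : nat) : bool :=
  (u %/ b ^ k.+1 == v %/ b ^ k.+1)%N && (ndigit b u k != ndigit b v k).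

Lemma topdiffP (b u v k : nat) : (1 < b)%N ->
  reflect ((forall j, (k < j)%N -> ndigit b u j = ndigit b v j) /\
           ndigit b u k <> ndigit b v k)
          (topdiff b u v k).
Proof.
move=> b1; apply: (iffP andP) => -[E /eqP nE]; split=> //.
  by move=> j kj; rewrite -(subnKC kj) -!ndigit_div (eqP E).
apply/eqP/(ndigit_inj b1)/funext => j.
by rewrite !ndigit_div E // leq_addr.
Qed.

(** Digitwise addition of [Q] is a bijection at each position, so it keeps the positions where two
    integers differ. What is found for [n < N] thus carries over to [nadd b n Q] and
    [nadd b N Q]. *)
Lemma topdiff_nadd (b u v Q k : nat) : (1 < b)%N ->
  topdiff b (nadd b u Q) (nadd b v Q) k = topdiff b u v k.
Proof.
move=> b1; have b0 := ltnW b1.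
apply/(topdiffP _ _ _ b1)/(topdiffP _ _ _ b1) => -[E nE]; split.
- move=> j /E; rewrite !ndigit_nadd //.
  by apply: addmod_inj; rewrite ltn_ndigit.
- by move=> h; apply: nE; rewrite !ndigit_nadd // h.
- by move=> j /E h; rewrite !ndigit_nadd // h.
- rewrite !ndigit_nadd // => h; apply: nE.
  by apply: addmod_inj h; rewrite ltn_ndigit.
Qed.

Lemma topdiffC (b u v k : nat) : topdiff b u v k = topdiff b v u k.
Proof. by rewrite /topdiff eq_sym [X in _ && ~~ X]eq_sym. Qed.

(** The smaller integer has the smaller digit at the top difference, so the larger one has a nonzero
    digit there. For a sparse [v] this leaves few possible positions. *)
Lemma ltn_topdiff (b u v : nat) : (1 < b)%N -> (u < v)%N ->
  exists2 k, topdiff b u v k & ndigit b v k != 0%N.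
Proof.
move=> b1; elim/ltn_ind: v u => v IH u uv.
have b0 := ltnW b1; have v0 : (0 < v)%N by apply: leq_ltn_trans uv.
have := leq_div2r b (ltnW uv); rewrite leq_eqVlt => /orP[/eqP E|lt].
  exists 0%N; rewrite /topdiff /ndigit ?expn1 ?expn0 ?divn1.
    rewrite E eqxx /=; apply/eqP => h.
    by move: uv; rewrite (divn_eq u b) (divn_eq v b) E h ltnn.
  apply: contraTneq uv => h; rewrite -leqNgt.
  by rewrite (divn_eq v b) h addn0 -E leq_divM.
have [k /(topdiffP _ _ _ b1)[E nE] vk] := IH _ (ltn_Pdiv b1 v0) _ lt.
exists k.+1; last by rewrite ndigitS.
apply/(topdiffP _ _ _ b1); split; last by rewrite !ndigitS.
by case=> // j kj; rewrite !ndigitS E.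
Qed.

Lemma topdiff_neq (b u v k : nat) : topdiff b u v k -> u != v.
Proof. by case/andP=> _; apply: contraNneq => ->. Qed.

(** Digits above [k] cancel, and without borrows the leading digit of the difference stays at
    [k]. *)
Lemma nvaluation_nsub (b u v k : nat) : (1 < b)%N -> topdiff b u v k ->
  nvaluation b (nsub b u v) = (b ^ k)%N.
Proof.
move=> b1 /(topdiffP _ _ _ b1)[E nE]; have b0 := ltnW b1.
rewrite /nvaluation (@trunc_log_eq b k) //; apply/andP; split.
  rewrite leqNgt; apply/negP => /ndigit_small /eqP.
  by rewrite ndigit_nsub // submod_eq0 ?ltn_ndigit // => /eqP.
apply: ltn_expn_digits => // j /E h.
by rewrite ndigit_nsub // h; apply/eqP; rewrite submod_eq0 ?ltn_ndigit.
Qed.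

(** * Digits of reals and digital shifts *)

Lemma sum_ndigit (b m n : nat) : (1 < b)%N -> (n < b ^ m)%N ->
  n = (\sum_(j < m) ndigit b n j * b ^ j)%N.
Proof.
move=> b1 nm; apply: (ndigit_inj b1); apply/funext => k.
have b0 := ltnW b1.
rewrite (@ndigit_sum _ _ (ndigit b n)) //; last by move=> j; apply: ltn_ndigit.
by case: ltnP => // h; rewrite (ndigit_ge b1 nm).
Qed.

Lemma sum_ndigit_frac (R : realType) (b m n : nat) : (1 < b)%N -> (n < b ^ m)%N ->
  \sum_(j < m) (ndigit b n (m - j.+1))%:R * b%:R ^- j.+1 = n%:R / b%:R ^+ m :> R.
Proof.
move=> b1 nm; rewrite [in RHS](sum_ndigit b1 nm) natr_sum mulr_suml.
rewrite (reindex_inj rev_ord_inj) /=; apply: eq_bigr => j _.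
have jm := ltn_ord j; have -> : (m - (m - j.+1).+1 = j)%N by lia.
rewrite natrM natrX -mulrA; congr (_ * _).
have b0 : b%:R != 0 :> R by rewrite pnatr_eq0; lia.
have -> : b%:R ^+ m = b%:R ^+ j * b%:R ^+ (m - j.+1).+1 :> R.
  by rewrite -exprD; congr (_ ^+ _); lia.
by rewrite invfM mulrA divff ?mul1r // expf_neq0.
Qed.

(** For [x] in [0, 1) this is the integer formed by the first [m] digits, so that [topdiff] serves
    for points as well as for indices. Digit [j] of [x] sits at position [m - j.+1]. *)
Definition bfloor (R : realType) (b m : nat) (x : R) : nat :=
  Num.truncn (x * b%:R ^+ m).

Lemma bfloor_itv (R : realType) (b m : nat) (x : R) : (1 < b)%N -> 0 <= x ->
  (bfloor b m x)%:R / b%:R ^+ m <= x < (bfloor b m x).+1%:R / b%:R ^+ m.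
Proof.
move=> b1 x0.
have bm : 0 < b%:R ^+ m :> R by rewrite exprn_gt0 // ltr0n ltnW.
rewrite ler_pdivrMr // ltr_pdivlMr //; apply: truncn_itv.
by rewrite mulr_ge0 // ltW.
Qed.

Lemma bfloor_def (R : realType) (b m n : nat) (x : R) : (1 < b)%N ->
  n%:R / b%:R ^+ m <= x < n.+1%:R / b%:R ^+ m -> bfloor b m x = n.
Proof.
move=> b1.
have bm : 0 < b%:R ^+ m :> R by rewrite exprn_gt0 // ltr0n ltnW.
by rewrite ler_pdivrMr // ltr_pdivlMr // => /truncn_def.
Qed.

Lemma bfloor_div (R : realType) (b m k : nat) (x : R) : (1 < b)%N -> 0 <= x ->
  (bfloor b (m + k) x %/ b ^ k)%N = bfloor b m x.
Proof.
move=> b1 x0; apply/esym/bfloor_def => //.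
have /andP[lo hi] := bfloor_itv (m + k) b1 x0.
have bm n : 0 < b%:R ^+ n :> R by rewrite exprn_gt0 // ltr0n ltnW.
move: lo hi; rewrite !ler_pdivrMr // !ltr_pdivlMr // exprD mulrA.
set n := bfloor _ _ _ => lo hi; apply/andP; split.
  rewrite -(ler_pM2r (bm k)); apply: le_trans lo.
  by rewrite -natrX -natrM ler_nat leq_divM.
rewrite -(ltr_pM2r (bm k)); apply: lt_le_trans hi _.
by rewrite -natrX -natrM ler_nat ltn_ceil // expn_gt0 ltnW.
Qed.

Lemma bfloor_lt (R : realType) (b m : nat) (x : R) : (1 < b)%N -> 0 <= x < 1 ->
  (bfloor b m x < b ^ m)%N.
Proof.
move=> b1 /andP[x0 x1].
have bm : 0 < b%:R ^+ m :> R by rewrite exprn_gt0 // ltr0n ltnW.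
have /andP[lo _] := bfloor_itv m b1 x0.
have := le_lt_trans lo x1; rewrite ltr_pdivrMr // mul1r.
by rewrite -natrX ltr_nat.
Qed.

Lemma digit_bfloor (R : realType) (b m j : nat) (x : R) :
  (1 < b)%N -> 0 <= x -> (j < m)%N ->
  digit b x j = ndigit b (bfloor b m x) (m - j.+1).
Proof.
move=> b1 x0 jm; rewrite /digit /ndigit -/(bfloor b j.+1 x).
by rewrite -(bfloor_div j.+1 (m - j.+1) b1 x0) subnKC.
Qed.

Lemma truncation_bfloor (R : realType) (b m : nat) (x : R) :
  (1 < b)%N -> 0 <= x < 1 -> truncation b m x = (bfloor b m x)%:R / b%:R ^+ m.
Proof.
move=> b1 x01; rewrite -(sum_ndigit_frac _ b1 (bfloor_lt m b1 x01)).
apply: eq_bigr => j _; rewrite (digit_bfloor b1 _ (ltn_ord j)) //.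
by case/andP: x01.
Qed.

Lemma frac_itv (R : realType) (b m n : nat) : (1 < b)%N -> (n < b ^ m)%N ->
  0 <= (n%:R / b%:R ^+ m : R) < 1.
Proof.
move=> b1 nm.
have bm : 0 < b%:R ^+ m :> R by rewrite exprn_gt0 // ltr0n ltnW.
rewrite divr_ge0 ?ler0n ?(ltW bm) //= ltr_pdivrMr // mul1r.
by rewrite -natrX ltr_nat.
Qed.

Lemma bfloor_frac (R : realType) (b m n : nat) : (1 < b)%N ->
  bfloor b m (n%:R / b%:R ^+ m : R) = n.
Proof.
move=> b1; apply: bfloor_def => //.
have bm : 0 < b%:R ^+ m :> R by rewrite exprn_gt0 // ltr0n ltnW.
by rewrite lexx /= ltr_pM2r ?invr_gt0 // ltr_nat.
Qed.

Lemma truncation_set_frac (R : realType) (b m n : nat) : (1 < b)%N ->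
  (n < b ^ m)%N -> truncation_set b m (n%:R / b%:R ^+ m : R).
Proof.
move=> b1 nm; have h := @frac_itv R _ _ _ b1 nm.
by exists (n%:R / b%:R ^+ m : R) => //; rewrite truncation_bfloor // bfloor_frac.
Qed.

(** Partial sums increase and stay at most [1 - b^-n], since one digit adds at most
    [b^-n - b^-(n+1)]. Hence the limit exists and dominates each of them. *)
Lemma ge_value (R : realType) (b m : nat) (v : nat -> nat) : (1 < b)%N ->
  (forall j, (v j < b)%N) ->
  \sum_(j < m) (v j)%:R * b%:R ^- j.+1 <= value R b v.
Proof.
move=> b1 vb; set u : R ^nat := fun j => (v j)%:R * b%:R ^- j.+1.
have bn n : 0 < b%:R ^+ n :> R by rewrite exprn_gt0 // ltr0n ltnW.
have u0 j : 0 <= u j by rewrite divr_ge0 // ltW.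
have incr : nondecreasing_seq (series u) by apply: nondecreasing_series.
rewrite -[leLHS](big_mkord predT u) -[leLHS]/(series u m).
apply: nondecreasing_cvgn_le => //; apply: nondecreasing_is_cvgn => //.
exists 1 => _ [n _ <-]; suff : series u n <= 1 - b%:R ^- n.
  by move=> h; apply: (le_trans h); rewrite gerBl invr_ge0 ltW.
elim: n => [|n IH].
  by rewrite seriesEord /= big_ord0 expr0 invr1 subrr.
have -> : series u n.+1 = series u n + u n.
  by rewrite !seriesEnat /= big_nat_recr.
have : u n <= b%:R ^- n - b%:R ^- n.+1.
  rewrite /u ler_pdivrMr // mulrBl mulVf ?lt0r_neq0 // exprSr mulrA.
  rewrite mulVf ?lt0r_neq0 //.
  rewrite mul1r lerBrDr -[1]/(1%:R) -natrD ler_nat; have := vb n; lia.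
lra.
Qed.

(** A lower bound suffices for counting from above: a shifted point below [G / b^m] has its first
    [m] shifted digits, read as an integer, below [G]. *)
Lemma digital_shift_ge (R : realType) (b m n : nat) (x : R) : (1 < b)%N ->
  0 <= x < 1 -> (n < b ^ m)%N ->
  (nadd b (bfloor b m x) n)%:R / b%:R ^+ m
    <= digital_shift b x (n%:R / b%:R ^+ m).
Proof.
move=> b1 x01 nm; have b0 := ltnW b1.
set v := fun j => addmod b (digit b x j) (digit b (n%:R / b%:R ^+ m : R) j).
apply: le_trans (@ge_value R b m v b1 _); last by move=> j; rewrite ltn_mod.
rewrite -sum_ndigit_frac //; last by apply: ltn_nadd => //; apply: bfloor_lt.
apply: ler_sum => j _; rewrite /v ndigit_nadd //.
rewrite !(@digit_bfloor _ _ m) ?bfloor_frac //; first by case/andP: x01.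
Qed.

(* A position [k] counted from the last of [m] digits is position [m - k] counted
   from the radix point. *)
Lemma valuation_dsub (R : realType) (b m k : nat) (x y : R) : (1 < b)%N ->
  0 <= x -> 0 <= y -> (k < m)%N ->
  topdiff b (bfloor b m x) (bfloor b m y) k ->
  valuation R b (dsub b x y) = b%:R ^- (m - k).
Proof.
move=> b1 x0 y0 km /(topdiffP _ _ _ b1)[E nE]; have b0 := ltnW b1.
have dE j : (dsub b x y j != 0%N) = (digit b x j != digit b y j).
  by rewrite /dsub submod_eq0 // ltn_mod.
have h : dsub b x y (m - k.+1)%N != 0%N.
  rewrite dE !(@digit_bfloor _ _ m) //; try lia.
  have -> : (m - (m - k.+1).+1 = k)%N by lia.
  exact/eqP.
rewrite /valuation; case: pselect => [ex|]; last by case; exists (m - k.+1)%N.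
case: ex_minnP => n /= nP nmin; have nk := nmin _ h.
suff -> : n = (m - k.+1)%N by congr (_ ^- _); lia.
apply/eqP; rewrite eqn_leq nk /= leqNgt; apply/negP => nlt.
move: nP; rewrite dE !(@digit_bfloor _ _ m) //; try lia.
by rewrite E ?eqxx //; lia.
Qed.

(** * Points at prescribed digit differences *)

Lemma card_cover (T I : finType) (S : pred T) (F : I -> pred T) :
  (forall x, S x -> exists i, F i x) -> (#|S| <= \sum_i #|F i|)%N.
Proof.
move=> cov; rewrite -sum1_card.
under [X in (_ <= X)%N]eq_bigr => i _ do rewrite -sum1_card big_mkcond /=.
rewrite exchange_big [X in (X <= _)%N]big_mkcond /=; apply: leq_sum => x _.
case: ifP => // /cov[i Fi]; rewrite (bigD1 i) //=.
by have -> : x \in F i by [].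
Qed.

Lemma leq_card_inj_in (T U : finType) (f : T -> U) (A : pred T) (B : pred U) :
  {in A &, injective f} -> (forall x, A x -> B (f x)) -> (#|A| <= #|B|)%N.
Proof.
move=> fi AB; rewrite -(card_in_imset fi); apply/subset_leq_card/fintype.subsetP.
by move=> _ /imsetP[x xA ->]; apply: AB.
Qed.

(** From position [k] up, [u] consists of the digits of [v] above [k] followed by a digit other than
    that of [v]; [bump] enumerates these [b - 1] digits. *)
Lemma topdiff_divn (b u v k : nat) : (1 < b)%N -> topdiff b u v k ->
  exists c : 'I_b.-1,
    (u %/ b ^ k = v %/ b ^ k.+1 * b + bump (ndigit b v k) c)%N.
Proof.
move=> b1 /andP[/eqP E nE]; have b0 := ltnW b1.
have ub := ltn_ndigit u k b0; have vb := ltn_ndigit v k b0.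
have cb : (unbump (ndigit b v k) (ndigit b u k) < b.-1)%N.
  move: nE; rewrite /unbump; case: ltnP => //=; lia.
exists (Ordinal cb) => /=; rewrite unbumpK; last exact: nE.
by rewrite -E expnSr divnMA /ndigit -divn_eq.
Qed.

Lemma ltn_divn_digit (b v k m e : nat) : (1 < b)%N -> (v < b ^ m)%N ->
  (k < m)%N -> (e < b)%N -> (v %/ b ^ k.+1 * b + e < b ^ (m - k))%N.
Proof.
move=> b1 vm km eb; have b0 := ltnW b1.
have h : (v %/ b ^ k.+1 < b ^ (m - k.+1))%N.
  by rewrite ltn_divLR ?expn_gt0 ?b0 // -expnD subnK.
have -> : (m - k = (m - k.+1).+1)%N by lia.
rewrite (expnS b (m - k.+1)) [(_ * b)%N]mulnC.
apply: (@leq_trans (b * (v %/ b ^ k.+1).+1)%N).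
  by rewrite mulnS addnC ltn_add2r.
by rewrite leq_mul2l h orbT.
Qed.

Lemma bump_lt (b e : nat) (c : 'I_b.-1) : (bump e c < b)%N.
Proof. by case: c => c /=; rewrite /bump; case: leqP; lia. Qed.

(** This is the net condition for block [A] of length [b^k] and a box with sides [b^-(r i)], whose
    volume is at least [b^(t-k)]. Truncation to [k] digits keeps the first [r i] digits because
    [r i <= k]. *)
Lemma sequence_card (R : realType) (b s t : nat) (x : nat -> 'I_s -> R)
    (A k : nat) (r a : 'I_s -> nat) :
    (1 < b)%N -> is_ts_sequence b t x -> (t < k)%N ->
    (\sum_i r i + t <= k)%N -> (forall i, (a i < b ^ r i)%N) ->
  #|[pred n : 'I_(b ^ k) |
      [forall i, bfloor b (r i) (x (A * b ^ k + n)%N i) == a i]]|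
  = (b ^ (k - \sum_i r i))%N.
Proof.
move=> b1 [cube net] tk rk ab; have b0 := ltnW b1.
have bn n : 0 < b%:R ^+ n :> R by rewrite exprn_gt0 // ltr0n.
have volE : box_volume b r = b%:R ^- (\sum_i r i)%N :> R.
  by rewrite /box_volume prodfV -expr_sum.
have [_ /(_ r a ab)] := net A k tk.
move=> /(_ (fun=> dvd1n _)); rewrite volE => H.
have {}H := H (_ : b%:R ^+ t / b%:R ^+ k <= b%:R ^- (\sum_i r i)%N).
have Sk : (\sum_i r i <= k)%N by apply: leq_trans rk; apply: leq_addr.
have rik i : (r i <= k)%N by apply: leq_trans Sk; rewrite (bigD1 i) //= leq_addr.
apply/eqP; rewrite -(eqr_nat R).
have -> : (b ^ (k - \sum_i r i))%N%:R = b%:R ^+ k * b%:R ^- (\sum_i r i)%N :> R.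
  by rewrite natrX expfB_cond // pnatr_eq0 eqn0Ngt b0.
apply/eqP; rewrite -H; last first.
  rewrite ler_pdivrMr // mulrC ler_pdivlMr // -exprD -!natrX ler_nat.
  by rewrite leq_exp2l // addnC.
congr (_%:R); apply: eq_card => n; rewrite !inE; apply: eq_forallb => i.
have xi := cube (A * b ^ k + n)%N i; have /andP[xi0 _] := xi.
rewrite truncation_bfloor //; set X := bfloor b k _.
have Xb : (X < b ^ k)%N by apply: bfloor_lt.
have /andP[y0 _] := @frac_itv R _ _ _ b1 Xb.
have -> : bfloor b (r i) (x (A * b ^ k + n)%N i) = bfloor b (r i) (X%:R / b%:R ^+ k : R).
  rewrite -(bfloor_div (r i) (k - r i) b1 xi0) -(bfloor_div (r i) (k - r i) b1 y0).
  by rewrite subnKC // bfloor_frac.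
apply/eqP/idP => [<-|]; first exact: bfloor_itv.
exact: bfloor_def.
Qed.

(** For this pair admissibility reads [b^-d <= b^k * b^-(\sum_i r i)]: position [m - r i] from the
    low end is the [r i]-th digit after the radix point. *)
Lemma admissible_sum_le (R : realType) (b s d : nat) (x : nat -> 'I_s -> R)
    (m n n' k : nat) (r : 'I_s -> nat) :
    (1 < b)%N -> admissible b d x -> (forall n i, 0 <= x n i) ->
    (forall i, (0 < r i <= m)%N) -> topdiff b n n' k ->
    (forall i, topdiff b (bfloor b m (x n i)) (bfloor b m (x n' i)) (m - r i)) ->
  (\sum_i r i <= k + d)%N.
Proof.
(* Admissibility speaks of ordered pairs, whereas [topdiff] is symmetric. *)
move=> b1 adm x0 rm; wlog n'n : n n' / (n' < n)%N.
  move=> H nk xr; have := topdiff_neq nk; rewrite neq_ltn => /orP[lt|lt].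
    by apply: (H _ _ lt); [rewrite topdiffC|move=> i; rewrite topdiffC].
  exact: (H _ _ lt).
move=> nk xr; have b0 := ltnW b1.
have bn j : 0 < b%:R ^+ j :> R by rewrite exprn_gt0 // ltr0n.
have vE i : valuation R b (dsub b (x n i) (x n' i)) = b%:R ^- r i.
  have /andP[r0 rl] := rm i.
  rewrite (@valuation_dsub _ _ m (m - r i)) //; last lia.
  by rewrite subKn.
have : b%:R ^- d <= (nvaluation b (nsub b n n'))%:R * valuation_sub b (x n) (x n').
  apply: le_trans adm _; apply: ge_inf; last by exists (n, n').
  exists 0 => _ [[p q] /= _ <-]; rewrite mulr_ge0 ?ler0n // prodr_ge0 // => i _.
  rewrite /valuation; case: pselect => // e; by rewrite invr_ge0 ltW.
rewrite (nvaluation_nsub b1 nk) /valuation_sub (eq_bigr _ (fun i _ => vE i)).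
rewrite prodfV -expr_sum natrX ler_pdivlMr // mulrC ler_pdivrMr // -exprD.
by rewrite -!natrX ler_nat leq_exp2l // addnC.
Qed.

(** There are [b - 1] choices for the differing digit of the index and of each coordinate. Each
    choice confines [n] to a block of length [b^k] and its point to an elementary box, where the net
    property counts. *)
Lemma difference_card (R : realType) (b s t : nat) (x : nat -> 'I_s -> R)
    (m n0 k : nat) (r : 'I_s -> nat) :
    (1 < b)%N -> is_ts_sequence b t x ->
    (n0 < b ^ m)%N -> (k < m)%N -> (forall i, (0 < r i <= m)%N) ->
    (t < k)%N -> (\sum_i r i + t <= k)%N ->
  (#|[pred n : 'I_(b ^ m) | topdiff b n n0 k &&
      [forall i, topdiff b (bfloor b m (x n i)) (bfloor b m (x n0 i)) (m - r i)]]|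
   <= b.-1 ^ s.+1 * b ^ (k - \sum_i r i))%N.
Proof.
move=> b1 hx n0m km rm tk rk; have b0 := ltnW b1; have [cube _] := hx.
pose X n i := bfloor b m (x n i).
pose A (c : 'I_b.-1) := (n0 %/ b ^ k.+1 * b + bump (ndigit b n0 k) c)%N.
pose a (c : {ffun 'I_s -> 'I_b.-1}) i :=
  (X n0 i %/ b ^ (m - r i).+1 * b + bump (ndigit b (X n0 i) (m - r i)) (c i))%N.
pose F (p : 'I_b.-1 * {ffun 'I_s -> 'I_b.-1}) : pred 'I_(b ^ m) :=
  [pred n : 'I_(b ^ m) | (n %/ b ^ k == A p.1)%N &&
     [forall i, bfloor b (r i) (x n i) == a p.2 i]].
have bfE n i : (X n i %/ b ^ (m - r i))%N = bfloor b (r i) (x n i).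
  have /andP[_ rl] := rm i; have /andP[x0 _] := cube n i.
  by rewrite -(bfloor_div (r i) (m - r i) b1 x0) subnKC.
apply: (@leq_trans (\sum_p #|F p|)).
  apply: card_cover => n /andP[/(topdiff_divn b1)[c cE] /forallP xr].
  have h i : exists c : 'I_b.-1, bfloor b (r i) (x n i) =
     (X n0 i %/ b ^ (m - r i).+1 * b + bump (ndigit b (X n0 i) (m - r i)) c)%N.
    by rewrite -bfE; apply: (topdiff_divn b1); apply: xr.
  exists (c, [ffun i => projT1 (cid (h i))]); apply/andP; split; first exact/eqP.
  by apply/forallP => i; rewrite /a /= ffunE; case: cid => /= e ->.
have -> : (b.-1 ^ s.+1 * b ^ (k - \sum_i r i) =
    \sum_(p : 'I_b.-1 * {ffun 'I_s -> 'I_b.-1}) b ^ (k - \sum_i r i))%N.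
  by rewrite sum_nat_const card_prod card_ffun !card_ord expnS.
apply: leq_sum => -[c c'] _ /=.
have bk : (0 < b ^ k)%N by rewrite expn_gt0 b0.
rewrite -(@sequence_card R b s t x (A c) k r (a c') b1 hx tk rk); last first.
  move=> i; have /andP[r0 rl] := rm i; rewrite /a -[X in (_ < b ^ X)%N](subKn rl).
  apply: ltn_divn_digit => //; [|lia|exact: bump_lt].
  by apply: bfloor_lt => //; apply: cube.
(* Within block [A c] an index is determined by its residue modulo [b^k]. *)
pose f (n : 'I_(b ^ m)) := Ordinal (ltn_pmod n bk).
have dE (n : 'I_(b ^ m)) : (n %/ b ^ k == A c)%N -> (A c * b ^ k + n %% b ^ k = n)%N.
  by move=> /eqP <-; rewrite -divn_eq.
apply: (@leq_card_inj_in _ _ f).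
  move=> n n' /andP[/dE nE _] /andP[/dE n'E _] /(congr1 val) /= h.
  by apply/val_inj; rewrite /= -nE -n'E h.
by move=> n /andP[/dE nE /= xr] /=; rewrite nE.
Qed.

(** * Sparse digit patterns and the excess of one cell *)

(** The integer with [h] digits [b - 1], spaced by [L] from position [c]. It yields [N] with
    [c = t], and [G] with [c = m %% L], which puts the digits of [G / b^m] at multiples of [L] after
    the radix point. *)
Definition comb (b c L h : nat) : nat := (\sum_(l < h) b.-1 * b ^ (c + L * l))%N.

Lemma ltn_combS (b c L h : nat) : (1 < b)%N -> (0 < L)%N ->
  (comb b c L h.+1 < b ^ (c + L * h).+1)%N.
Proof.
move=> b1 L0; have b0 := ltnW b1.
have step u e : (u < b ^ e -> u + b.-1 * b ^ e < b ^ e.+1)%N.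
  by move=> ue; rewrite expnS -[X in (_ < X * _)%N](prednK b0) mulSn ltn_add2r.
elim: h => [|h IH]; rewrite /comb big_ord_recr /=; apply: step.
  by rewrite big_ord0 expn_gt0 b0.
apply: leq_trans IH _; rewrite leq_exp2l //; nia.
Qed.

Lemma comb_gt0 (b c L h : nat) : (1 < b)%N -> (0 < h)%N -> (0 < comb b c L h)%N.
Proof.
case: h => // h b1 _; rewrite /comb big_ord_recl addn_gt0 muln_gt0 expn_gt0.
by rewrite (ltnW b1) andbT -subn1 subn_gt0 b1.
Qed.

Lemma ndigit_comb (b c L h k : nat) : (1 < b)%N -> (0 < L)%N ->
  ndigit b (comb b c L h) k != 0%N -> exists l : 'I_h, k = (c + L * l)%N.
Proof.
move=> b1 L0; have b0 := ltnW b1.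
have bp : (b.-1 < b)%N by rewrite prednK.
elim: h => [|h IH]; first by rewrite /comb big_ord0 /ndigit div0n mod0n.
have [->|ke] := eqVneq k (c + L * h)%N; first by exists ord_max.
have [kgt|kle] := ltnP (c + L * h) k.
  by rewrite (ndigit_ge b1 (ltn_combS c h b1 L0) kgt).
have {kle}ke : (k < c + L * h)%N by rewrite ltn_neqAle ke.
rewrite /comb big_ord_recr /= -/(comb b c L h).
suff -> : ndigit b (comb b c L h + b.-1 * b ^ (c + L * h)) k =
          ndigit b (comb b c L h) k.
  by move=> /IH[l ->]; exists (widen_ord (leqnSn h) l).
(* The added term is a multiple of [b^(k+1)], so it leaves digit [k] alone. *)
have -> : (b ^ (c + L * h) = b ^ (c + L * h - k.+1) * b * b ^ k)%N.
  by rewrite -expnSr -expnD; congr (_ ^ _)%N; lia.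
rewrite /ndigit mulnA [(b.-1 * _)%N]mulnA.
by rewrite addnC divnMDl ?expn_gt0 ?b0 // modnMDl.
Qed.

Lemma comb_frac (R : realType) (b L m : nat) : (0 < b)%N -> (0 < L)%N ->
  (comb b (m %% L) L (m %/ L))%:R / b%:R ^+ m =
  \sum_(l < m %/ L) b.-1%:R * b%:R ^- (L * l.+1) :> R.
Proof.
move=> b0 L0; rewrite /comb natr_sum mulr_suml (reindex_inj rev_ord_inj) /=.
apply: eq_bigr => l _; rewrite natrM natrX -mulrA; congr (_ * _).
have lt := ltn_ord l; have mE := divn_eq m L.
have bn n : b%:R ^+ n != 0 :> R by rewrite expf_neq0 // pnatr_eq0 -lt0n.
rewrite [in b%:R ^+ m](_ : m = (m %% L + L * (m %/ L - l.+1) + L * l.+1)%N).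
  by rewrite (exprD _ (m %% L + _)) invfM mulrA divff // mul1r.
by rewrite [LHS]mE mulnC addnC -addnA -mulnDr subnK.
Qed.

(** If every [v i] is below [h %/ s], the sum of the [(v i).+1] is between 1 and [h], so it
    determines an admissible first component; [v] itself is free. *)
Lemma sum_succ_card (s h : nat) : (0 < s)%N ->
  ((h %/ s) ^ s <= #|[pred p : 'I_h * {ffun 'I_s -> 'I_h} |
                     \sum_i (p.2 i).+1 == p.1.+1]|)%N.
Proof.
move=> s0; set q := (h %/ s)%N.
have qsh : (s * q <= h)%N by rewrite mulnC leq_divM.
have qh : (q <= h)%N by apply: leq_trans qsh; rewrite leq_pmull.
have pos (v : {ffun 'I_s -> 'I_q}) : (0 < \sum_i (v i).+1)%N.
  by rewrite (bigD1 (Ordinal s0)).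
have sl (v : {ffun 'I_s -> 'I_q}) : ((\sum_i (v i).+1).-1 < h)%N.
  rewrite prednK //; apply: leq_trans qsh.
  rewrite -[s in (s * q)%N]card_ord -sum_nat_const.
  by apply: leq_sum => i _; apply: ltn_ord.
pose f (v : {ffun 'I_s -> 'I_q}) : 'I_h * {ffun 'I_s -> 'I_h} :=
  (Ordinal (sl v), [ffun i => widen_ord qh (v i)]).
have -> : (q ^ s = #|[pred v : {ffun 'I_s -> 'I_q} | true]|)%N.
  by rewrite -[LHS](_ : #|{ffun 'I_s -> 'I_q}| = _) ?card_ffun ?card_ord.
apply: (@leq_card_inj_in _ _ f).
  move=> u v _ _ [_ /ffunP uv]; apply/ffunP => i; have := uv i.
  by rewrite !ffunE => /(congr1 val) /= /val_inj.
move=> v _ /=; rewrite prednK //; apply/eqP; apply: eq_bigr => i _.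
by rewrite ffunE.
Qed.

(** If [e <= l], then [L * e + t <= t + L * l] and the net count applies. If [e > l], a point in the
    cell would give [L * e <= t + L * l + d = L * l.+1 - 1], so the cell is empty; for [e = l.+1]
    its expected count is exactly the subtracted constant. *)
Lemma local_excess (R : realType) (b s d t : nat) (x : nat -> 'I_s -> R)
    (m n0 : nat) (l : 'I_(m %/ (d + t).+1))
    (v : {ffun 'I_s -> 'I_(m %/ (d + t).+1)}) :
    let L := (d + t).+1 in let e := (\sum_i (v i).+1)%N in
    (1 < b)%N -> (0 < s)%N -> admissible b d x -> is_ts_sequence b t x ->
    (n0 < b ^ m)%N ->
  #|[pred n : 'I_(b ^ m) | topdiff b n n0 (t + L * l) &&
      [forall i, topdiff b (bfloor b m (x n i)) (bfloor b m (x n0 i))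
                             (m - L * (v i).+1)]]|%:R
  <= b.-1%:R ^+ s.+1 * b%:R ^+ (t + L * l) / b%:R ^+ (L * e)
     - (e == l.+1)%:R * (b.-1%:R ^+ s.+1 / b%:R ^+ d.+1) :> R.
Proof.
move=> L e b1 s0 adm hx n0m; have b0 := ltnW b1; have [cube _] := hx.
have bn j : 0 < b%:R ^+ j :> R by rewrite exprn_gt0 // ltr0n.
have x0 n i : 0 <= x n i by case/andP: (cube n i).
have vh i : (L * (v i).+1 <= m)%N.
  by apply: leq_trans (leq_divM m L); rewrite mulnC leq_mul2r ltn_ord orbT.
have lh : (L * l.+1 <= m)%N.
  by apply: leq_trans (leq_divM m L); rewrite mulnC leq_mul2r ltn_ord orbT.
have kL : ((t + L * l).+1 + d = L * l.+1)%N by rewrite mulnS /L; lia.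
have rm i : (0 < L * (v i).+1 <= m)%N by rewrite vh.
have sumr : (\sum_i L * (v i).+1 = L * e)%N by rewrite -big_distrr.
have km : (t + L * l < m)%N by lia.
set S := [pred n | _].
have [el|le] := leqP e l.
  have -> : (e == l.+1) = false by apply/negbTE; rewrite neq_ltn ltnS el.
  (* With [e <= l] this forces [l > 0], hence the strict [t < t + L * l] that the net count
     requires. *)
  have e0 : (0 < e)%N by rewrite /e (bigD1 (Ordinal s0)).
  have Lel : (L * e <= L * l)%N by rewrite leq_mul2l el orbT.
  have := @difference_card R b s t x m n0 _ _ b1 hx n0m km rm.
  rewrite sumr => H.
  rewrite mul0r subr0.
  have -> : b.-1%:R ^+ s.+1 * b%:R ^+ (t + L * l) / b%:R ^+ (L * e) =
    (b.-1 ^ s.+1 * b ^ (t + L * l - L * e))%N%:R :> R.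
    rewrite natrM !natrX -mulrA expfB_cond // pnatr_eq0 eqn0Ngt b0 add0n.
    by apply: leq_trans Lel _; apply: leq_addl.
  rewrite ler_nat; apply: H; nia.
have -> : #|S| = 0%N.
  apply/eqP; rewrite eqn0Ngt; apply/negP => /card_gt0P[n /andP[nk /forallP nr]].
  have := @admissible_sum_le R b s d x m n n0 _ _ b1 adm x0 rm nk nr.
  rewrite sumr.
  have : (L * l.+1 <= L * e)%N by rewrite leq_mul2l le orbT.
  lia.
have [->|_] := eqVneq e l.+1; last first.
  by rewrite mul0r subr0 divr_ge0 ?mulr_ge0 ?exprn_ge0 // ltW.
rewrite mul1r -kL addSnnS (exprD _ (t + L * l)) invfM [X in _ <= X - _]mulrA.
by rewrite mulfK ?lt0r_neq0 // subrr.
Qed.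

(** * The discrepancy bound *)

Lemma Delta_witness (R : realType) (b s d t m Q : nat) (x : nat -> 'I_s -> R) :
    let h := (m %/ (d + t).+1)%N in
    (1 < b)%N -> (0 < s)%N -> (0 < h)%N ->
    admissible b d x -> is_ts_sequence b t x -> (Q < b ^ m)%N ->
  exists (N : nat) (w g : 'I_s -> R),
    [/\ (1 <= N <= b ^ m)%N, forall i, truncation_set b m (w i),
        forall i, 0 < g i <= 1 &
        Delta N (shifted b x Q w) g
          <= - (((h %/ s) ^ s)%N%:R * (b.-1%:R ^+ s.+1 / b%:R ^+ d.+1))].
Proof.
move=> h b1 s0 h0 adm hx Qm; have b0 := ltnW b1; have [cube _] := hx.
have bn j : 0 < b%:R ^+ j :> R by rewrite exprn_gt0 // ltr0n.
set L := (d + t).+1 in h h0 *.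
have L0 : (0 < L)%N by [].
have Lhm : (L * h <= m)%N by rewrite mulnC leq_divM.
have combm c : (c < L)%N -> (comb b c L h < b ^ m)%N.
  move=> cL; rewrite -[h]prednK //; apply: leq_trans (ltn_combS c h.-1 b1 L0) _.
  rewrite leq_exp2l //; apply: leq_trans Lhm; rewrite -{2}[h]prednK // mulnS.
  by rewrite -addSn leq_add2r.
pose N := comb b t L h; pose G := comb b (m %% L) L h.
have Nm : (N < b ^ m)%N by apply: combm; rewrite /L; lia.
have Gm : (G < b ^ m)%N by apply: combm; rewrite ltn_mod.
pose n0 := nadd b N Q.
have n0m : (n0 < b ^ m)%N by apply: ltn_nadd.
pose X n i := bfloor b m (x n i).
have Xm n i : (X n i < b ^ m)%N by apply: bfloor_lt => //; apply: cube.
(* Chosen so that adding [W i] digitwise to [X n0 i] gives [G]. *)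
pose W i := nsub b G (X n0 i).
have Wm i : (W i < b ^ m)%N by apply: ltn_nsub.
pose w i : R := (W i)%:R / b%:R ^+ m.
pose g (i : 'I_s) : R := G%:R / b%:R ^+ m.
exists N, w, g; split.
- by rewrite comb_gt0 // ltnW.
- by move=> i; apply: truncation_set_frac.
- move=> i; rewrite divr_gt0 ?ltr0n ?comb_gt0 //=.
  by rewrite ler_pdivrMr // mul1r -natrX ler_nat ltnW.
pose I : finType := ('I_h * {ffun 'I_s -> 'I_h})%type.
pose S (p : I) := [pred n : 'I_(b ^ m) | topdiff b n n0 (t + L * p.1) &&
  [forall i, topdiff b (X n i) (X n0 i) (m - L * (p.2 i).+1)]].
pose E (p : I) : R := b.-1%:R ^+ s.+1 * b%:R ^+ (t + L * p.1)
  / b%:R ^+ (L * \sum_i (p.2 i).+1).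
(* Expanding [N] and the [s] factors [G / b^m] digit by digit splits the expected count over the
   cells [(l, v)]. *)
have volE : N%:R * \prod_i g i = \sum_p E p.
  rewrite /g /G comb_frac // bigA_distr_bigA /= /N /comb natr_sum.
  rewrite mulr_suml -(pair_bigA _ (fun l v => E (l, v))) /=.
  apply: eq_bigr => l _; rewrite mulr_sumr; apply: eq_bigr => v _.
  rewrite big_split /= prodr_const card_ord prodfV -expr_sum -big_distrr /=.
  by rewrite /E /= natrM natrX exprS; ring.
(* Every counted index lies in some cell: [n < N] places its top difference from [N] at a nonzero
   digit of [N], and each shifted coordinate below [g i] does the same with [G]. *)
have cntE : (#|[pred n : 'I_N | [forall i, (0 <= shifted b x Q w n i < g i)%R]]|
             <= \sum_p #|S p|)%N.
  apply: (@leq_trans #|[pred n : 'I_(b ^ m) | [exists p, S p n]]|); last first.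
    by apply: card_cover => n /existsP.
  have fm (n : 'I_N) : (nadd b n Q < b ^ m)%N.
    by apply: ltn_nadd => //; apply: ltn_trans Nm.
  apply: (@leq_card_inj_in _ _ (fun n : 'I_N => Ordinal (fm n))).
    by move=> n n' _ _ /(congr1 val) /= /(nadd_inj b1) /val_inj.
  move=> n /forallP yg; apply/existsP.
  have [k nk Nk] := ltn_topdiff b1 (ltn_ord n).
  have [l kE] := ndigit_comb b1 L0 Nk.
  have hv i : exists v : 'I_h,
      topdiff b (X (nadd b n Q) i) (X n0 i) (m - L * v.+1).
    have /andP[_ lt] := yg i.
    have le := @digital_shift_ge R b m (W i) _ b1 (cube (nadd b n Q) i) (Wm i).
    have := le_lt_trans le lt; rewrite ltr_pM2r ?invr_gt0 // ltr_nat.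
    have GE : G = nadd b (X n0 i) (W i) by rewrite nsubK.
    move=> /(ltn_topdiff b1)[k' + Gk']; rewrite [X in topdiff _ _ X]GE.
    rewrite topdiff_nadd //; have [j ->] := ndigit_comb b1 L0 Gk'.
    (* Digit [j] of [G] from the low end is the one at [L * (h - j)] after the radix point. *)
    exists (rev_ord j); rewrite /=.
    suff -> : (m - L * (h - j.+1).+1 = m %% L + L * j)%N by [].
    rewrite subnSK // mulnBr {1}(divn_eq m L) -/h mulnC.
    have : (L * j <= L * h)%N by rewrite leq_mul2l (ltnW (ltn_ord j)) orbT.
    lia.
  exists (l, [ffun i => projT1 (cid (hv i))]); apply/andP; split => /=.
    by rewrite topdiff_nadd // -kE.
  by apply/forallP => i; rewrite ffunE; case: cid.
rewrite /Delta volE lerBlDl.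
apply: le_trans (_ : (\sum_p #|S p|)%N%:R <= _); first by rewrite ler_nat.
set c := _ / _.
apply: (@le_trans _ _
   (\sum_p (E p - (\sum_i (p.2 i).+1 == p.1.+1)%N%:R * c))).
  by rewrite natr_sum; apply: ler_sum => -[l v] _; apply: local_excess.
rewrite sumrB lerD2l lerN2 -mulr_suml ler_pM2r; last first.
  by rewrite divr_gt0 // exprn_gt0 // ltr0n -subn1 subn_gt0.
rewrite -natr_sum ler_nat; apply: leq_trans (sum_succ_card h s0) _.
by rewrite -sum1_card big_mkcond.
Qed.

(** Both terms of [Delta] lie between 0 and [N], so the supremum is finite. The upper bound also
    makes the supremum in [max_discrepancy] finite. *)
Lemma star_discrepancy_bounds (R : realType) (s N : nat) (y : nat -> 'I_s -> R)
    (g : 'I_s -> R) :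
  (0 < N)%N -> (forall i, 0 < g i <= 1) ->
  `|Delta N y g| <= N%:R * star_discrepancy N y /\ N%:R * star_discrepancy N y <= N%:R.
Proof.
move=> N0 g01; have N0' : 0 < N%:R :> R by rewrite ltr0n.
set A := [set `|Delta N y g'| / N%:R | g' in [set g' | forall i, 0 < g' i <= 1]]%classic.
have bound : ubound A 1.
  move=> _ [f f01 <-]; rewrite ler_pdivrMr // mul1r /Delta ler_norml.
  have p0 : 0 <= \prod_i f i by apply: prodr_ge0 => i _; case/andP: (f01 i) => /ltW.
  have p1 : \prod_i f i <= 1.
    by apply: prodr_ile1 => i _; case/andP: (f01 i) => /ltW -> ->.
  set c := #|_|; have cN : c%:R <= N%:R :> R.
    by rewrite ler_nat -[X in (_ <= X)%N]card_ord max_card.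
  have c0 : 0 <= c%:R :> R by [].
  have q0 : 0 <= N%:R * \prod_i f i by rewrite mulr_ge0.
  have q1 : N%:R * \prod_i f i <= N%:R by rewrite ler_piMr.
  lra.
have Ag : A (`|Delta N y g| / N%:R) by exists g.
split.
  rewrite mulrC -ler_pdivrMr //; apply: ub_le_sup => //; by exists 1.
by rewrite ler_piMr ?ler0n //; apply: ge_sup => //; exists (`|Delta N y g| / N%:R).
Qed.

Lemma max_discrepancy_ge (R : realType) (b s m Q N : nat) (x : nat -> 'I_s -> R)
    (w g : 'I_s -> R) :
  (1 <= N <= b ^ m)%N -> (forall i, truncation_set b m (w i)) ->
  (forall i, 0 < g i <= 1) ->
  - Delta N (shifted b x Q w) g <= max_discrepancy b m x Q.
Proof.
move=> Nm wm g01; have /andP[N0 _] := Nm.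
have [le _] := star_discrepancy_bounds (shifted b x Q w) N0 g01.
apply: le_trans (le_trans le _); first by rewrite ler_normr lexx orbT.
apply: ub_le_sup; last by exists (N, w).
exists (b ^ m)%N%:R => _ [[M v] /= [/andP[M0 Mm] _] <-].
have [_ h] := star_discrepancy_bounds (shifted b x Q v) M0 g01.
by apply: le_trans h _; rewrite ler_nat.
Qed.

Unset Implicit Arguments.

Theorem theorem2 (R : realType) (b s d t : nat) (x : nat -> 'I_s -> R)
    (hb : (2 <= b)%N) (hs : (1 <= s)%N) (hd : (1 <= d)%N)
    (hadm : admissible b d x) (hseq : is_ts_sequence b t x)
    (m : nat) (hm : (9 * (d + t) * s ^ 2 <= m)%N) :
  b%:R ^- d * ((4 * (d + t) * s ^ 2)%N%:R) ^- s * m%:R ^+ s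
    <= 1 + minmax_discrepancy b m x.
Proof.
have b0 : (0 < b)%N by apply: ltnW.
have bn j : 0 < b%:R ^+ j :> R by rewrite exprn_gt0 // ltr0n.
set L := (d + t).+1; set q := (m %/ L %/ s)%N.
have h0 : (0 < m %/ L)%N by rewrite divn_gt0 // /L; nia.
(* Since [d >= 1], [L = d + t + 1] is at most [2 * (d + t)]. *)
have qm : (m < q.+1 * (2 * (d + t) * s))%N.
  have : (m < q.+1 * (L * s))%N.
    by rewrite /q -divnMA; apply: ltn_ceil; rewrite muln_gt0 hs.
  move=> /leq_trans; apply; rewrite leq_mul2l /=.
  by rewrite leq_mul2r /L; lia.
have lower : (q ^ s)%N%:R * (b.-1%:R ^+ s.+1 / b%:R ^+ d.+1) <= minmax_discrepancy b m x.
  apply: lb_le_inf; first by exists (max_discrepancy b m x 0), 0%N => //=; rewrite expn_gt0 b0.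
  move=> _ [Q /= Qm <-].
  have [N [w [g [Nm wm g01 D]]]] := Delta_witness hb hs h0 hadm hseq Qm.
  by apply: le_trans (max_discrepancy_ge Q x Nm wm g01); rewrite lerNr.
apply: le_trans (_ : 1 + (q ^ s)%N%:R * (b.-1%:R ^+ s.+1 / b%:R ^+ d.+1) <= _); last first.
  by rewrite lerD2l.
have bd1 : b%:R ^- d <= 1 :> R.
  by rewrite invf_le1 // -natrX ler1n expn_gt0 b0.
(* It amounts to [b <= 2 * (b - 1)^(s+1)], which follows from [b <= 2 * (b - 1)]. *)
have half : b%:R ^- d / 2 <= b.-1%:R ^+ s.+1 / b%:R ^+ d.+1 :> R.
  rewrite (exprSr b%:R d) invfM mulrCA.
  apply: ler_wpM2l.
    by rewrite invr_ge0 ltW.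
  rewrite ler_pdivlMr ?ltr0n // mulrC ler_pdivrMr // -natrX -natrM ler_nat.
  apply: (@leq_trans (b.-1 * 2)); first by lia.
  by rewrite leq_mul2r /= -[X in (X <= _)%N]expn1 leq_pexp2l //; lia.
set D := (d + t)%N in hm qm *; have D0 : (0 < D)%N by rewrite /D; lia.
have K0 : 0 < (4 * D * s ^ 2)%N%:R :> R by rewrite ltr0n !muln_gt0 D0 hs.
rewrite -mulrA -[_ ^- s]exprVn -exprMn; set z := _%:R^-1 * _.
have z0 : 0 <= z by rewrite mulr_ge0 // invr_ge0 ltW.
have zq : z <= q.+1%:R / 2 / s%:R.
  rewrite /z mulrC ler_pdivrMr //.
  have -> : (4 * D * s ^ 2)%N%:R = 2 * (s%:R * (2 * D * s)%N%:R) :> R.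
    by rewrite -!natrM; congr _%:R; ring.
  have -> : q.+1%:R / 2 / s%:R * (2 * (s%:R * (2 * D * s)%N%:R)) =
     (q.+1 * (2 * D * s))%N%:R :> R.
    by rewrite (natrM _ q.+1); field; rewrite pnatr_eq0 -lt0n.
  by rewrite ler_nat ltnW.
(* For [s = 1] the bound [zq] is already this. For [s >= 2] the size of [m] forces [q >= 1], so
   [z <= (q + 1) / 4 <= q / 2]. The extra 1/2 is absorbed by the 1 added to the discrepancy, as
   [b^-d <= 1]. *)
have key : z ^+ s <= (q ^ s)%N%:R / 2 + 1 / 2.
  have [s1|s2] := leqP s 1.
    have sE : s = 1%N by apply/eqP; rewrite eqn_leq s1.
    by move: zq; rewrite sE !expr1 expn1 divr1 -natr1; lra.
  have zq2 : z <= q%:R / 2.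
    apply: le_trans zq _; rewrite ler_pdivrMr ?ltr0n // -natr1.
    have q1 : 1 <= q%:R :> R by rewrite ler1n; nia.
    have s2' : 2 <= s%:R :> R by rewrite ler_nat.
    nra.
  have q0 : 0 <= q%:R ^+ s :> R by rewrite exprn_ge0.
  have : z ^+ s <= q%:R ^+ s * 2^-1 ^+ s.
    by rewrite -exprMn lerXn2r ?nnegrE ?divr_ge0.
  have : (2^-1 : R) ^+ s <= 2^-1.
    by rewrite -[leRHS]expr1 ler_wiXn2l // ?invr_ge0 // invf_le1 // ler1n.
  rewrite natrX => /(ler_wpM2l q0) h2 h3; lra.
have B0 : 0 <= b%:R ^- d :> R by rewrite invr_ge0 ltW.
have q0 : 0 <= (q ^ s)%N%:R :> R by [].
apply: (@le_trans _ _ (b%:R ^- d * ((q ^ s)%N%:R / 2 + 1 / 2))).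
  by rewrite ler_wpM2l.
have := ler_wpM2l q0 half; lra.
Qed.
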